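(* Let $n\ge1$, let $\mathcal{E}$ be a Hilbert space, let $(W_L,S^{\mathcal{E}})$ be a Fock representation of $O_n$, and let $\mathcal{S}\subseteq\mathcal{F}^2_n\otimes\mathcal{E}$ be a closed subspace invariant under $(W_L,S^{\mathcal{E}})$. Then the subrepresentation $(W_L|_{\mathcal{S}},S^{\mathcal{E}}|_{\mathcal{S}})$ is, up to unitary equivalence, also a Fock representation: there exist a Hilbert space $\mathcal{E}_*$ and a Fock representation $(W_{L_*},S^{\mathcal{E}_*})$ of $O_n$ such that $(W_L|_{\mathcal{S}},S^{\mathcal{E}}|_{\mathcal{S}})\cong(W_{L_*},S^{\mathcal{E}_*})$.
   Context: All Hilbert spaces are complex and separable. $F_n^+$ is the free semigroup on letters $g_1,\dots,g_n$ with identity $g_0$. The Fock space is $\mathcal{F}^2_n=\mathbb{C}\Omega\oplus\bigoplus_{k\ge1}(\mathbb{C}^n)^{\otimes k}$ with vacuum unit vector $\Omega$; $\{e_1,\dots,e_n\}$ is the standard basis of $\mathbb{C}^n$; $e_\mu=e_{\mu_1}\otimes\cdots\otimes e_{\mu_k}$ for $\mu=g_{\mu_1}\cdots g_{\mu_k}$ and $e_{g_0}=\Omega$. The creation operators are $S_if=e_i\otimes f$, and $S^{\mathcal{E}}=(S_1\otimes I_{\mathcal{E}},\dots,S_n\otimes I_{\mathcal{E}})$. Odometer map: for $L\in\mathcal{B}(\mathcal{E},\mathcal{F}^2_n\otimes\mathcal{E})$, $W_L$ is the linear map on the dense linear span of $\{e_\mu\otimes\eta:\mu\in F_n^+,\eta\in\mathcal{E}\}$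 given by $W_L(\Omega\otimes\eta)=L\eta$; $W_L(e_n^{\otimes m}\otimes\eta)=(S_1^m\otimes I_{\mathcal{E}})L\eta$ for $m\ge1$; and $W_L(e_n^{\otimes j}\otimes e_i\otimes e_\nu\otimes\eta)=e_1^{\otimes j}\otimes e_{i+1}\otimes e_\nu\otimes\eta$ for $j\ge0$, $1\le i\le n-1$, $\nu\in F_n^+$. When this map is bounded, $W_L$ also denotes its bounded extension. $(W,T)$ with $T=(T_1,\dots,T_n)$ is a representation of the odometer semigroup $O_n$ if $WT_i=T_{i+1}$ for $1\le i\le n-1$ and $WT_n=T_1W$. A Fock representation is a representation $(W,S^{\mathcal{E}})$ with $W\in\mathcal{B}(\mathcal{F}^2_n\otimes\mathcal{E})$ (so ''$(W_L,S^{\mathcal{E}})$ is a Fock representation'' includes that $W_L$ is bounded). A closed subspace $\mathcal{S}$ is invariant under $(W_L,S^{\mathcal{E}})$ if $(S_i\otimes I_{\mathcal{E}})\mathcal{S}\subseteq\mathcal{S}$ for all $i$ and $W_L\mathcal{S}\subseteq\mathcal{S}$; then $S^{\mathcal{E}}|_{\mathcal{S}}=((S_1\otimes I_{\mathcal{E}})|_{\mathcal{S}},\dots,(S_n\otimes I_{\mathcal{E}})|_{\mathcal{S}})$. Tuples $(A_0,\dots,A_n)$ on $\mathcal{H}$ and $(B_0,\dots,B_n)$ on $\mathcal{K}$ satisfy $(A_0,\dots,A_n)\cong(B_0,\dots,B_n)$ if there is a single unitary $U:\mathcal{H}\to\mathcal{K}$ with $UA_i=B_iU$ for all $i$. *)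

(* Defs.v *)
(* This development uses MathComp and MathComp-Analysis over an arbitrary
   [R : realType]; complex scalars are [R[i]]. *)
From HB Require Import structures.
From mathcomp Require Import all_boot all_order all_algebra.
From mathcomp Require Import complex ring.
From mathcomp Require Import boolp classical_sets functions cardinality reals.
From mathcomp Require Import topology normedtype sequences.

Set Implicit Arguments.
Unset Strict Implicit.
Unset Printing Implicit Defensive.
Import Order.TTheory GRing.Theory Num.Theory numFieldNormedType.Exports.
Local Open Scope classical_set_scope.
Local Open Scope ring_scope.

HB.instance Definition _ (R : realType) := NormedModule.copy R[i] R[i]^o.

Section ComplexTopology.
Variable R : realType.
Local Notation C := R[i].
Local Notation toC := (real_complex R).
Local Notation Re := (@complex.Re R).
Local Notation Im := (@complex.Im R).

Lemma normcR (x : R) : `|toC x| = toC `|x|.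
Proof.
by rewrite normc_def /= expr0n addr0 sqrtr_sqr.
Qed.

Lemma gt0C (e : C) : 0 < e -> exists2 d : R, 0 < d & e = toC d.
Proof.
move=> e0; exists (Re e).
  by rewrite -ltcR RRe_real // gtr0_real.
by rewrite RRe_real // gtr0_real.
Qed.

Lemma ge0C (z : C) : 0 <= z -> z = toC (Re z).
Proof. by move=> z0; rewrite RRe_real // ger0_real. Qed.

Lemma cvgC (T : Type) (F : set_system T) {FF : Filter F} (f g : T -> R) (a b : R) :
  f @ F --> a -> g @ F --> b ->
  ((fun t => Complex (f t) (g t)) : T -> C) @ F --> (Complex a b : C).
Proof.
move=> fa gb; apply/cvgrPdist_lt => e /gt0C[d d0 ->].
have d2 : 0 < d / 2 by rewrite divr_gt0.
move/cvgrPdist_lt : fa => /(_ _ d2) fa.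
move/cvgrPdist_lt : gb => /(_ _ d2) gb.
near=> t.
have -> : Complex a b - Complex (f t) (g t) =
    toC (a - f t) + 'i%C * toC (b - g t) :> C.
  by rewrite [LHS]complexE.
apply: le_lt_trans (ler_normD _ _) _.
have i1 : `|('i%C : C)| = 1 by rewrite normc_def/= expr0n/= add0r expr1n sqrtr1.
rewrite normrM i1 mul1r !normcR -rmorphD ltcR (splitr d) ltrD //.
- by near: t.
- by near: t.
Unshelve. all: by end_near. Qed.

Lemma ler_RenormC (z : C) : `|Re z| <= Re `|z|.
Proof. by have := normc_ge_Re z; rewrite [in X in _ <= X](ge0C (normr_ge0 z)) lecR. Qed.

Lemma ler_ImnormC (z : C) : `|Im z| <= Re `|z|.
Proof.
have := ler_RenormC (z * 'i%C); rewrite ReiNIm normrN normrM.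
have -> : `|('i%C : C)| = 1 by rewrite normc_def/= expr0n/= add0r expr1n sqrtr1.
by rewrite mulr1.
Qed.

Lemma complex_complete (F : set_system C) : ProperFilter F -> cauchy F -> cvg F.
Proof.
move=> FF /cauchy_ballP F_cauchy.
have ReF : cvg (Re @ F).
  apply: cauchy_cvg; apply/cauchy_ballP => e e0.
  have := F_cauchy (toC e); rewrite ltcR => /(_ e0).
  move=> [[A B]] /= [FA FB] AB; exists (Re @` A, Re @` B).
    by split => /=; rewrite nbhs_simpl /=;
      [apply: filterS FA|apply: filterS FB] => z ?; exists z.
  move=> [_ _] /= [[x Ax <-] [y By <-]].
  have /= := AB (x, y) (conj Ax By); rewrite -!ball_normE /=.
  rewrite -[`|x - y|](RRe_real (normr_real _)) ltcR.
  by apply: le_lt_trans; rewrite -raddfB ler_RenormC.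
have ImF : cvg (Im @ F).
  apply: cauchy_cvg; apply/cauchy_ballP => e e0.
  have := F_cauchy (toC e); rewrite ltcR => /(_ e0).
  move=> [[A B]] /= [FA FB] AB; exists (Im @` A, Im @` B).
    by split => /=; rewrite nbhs_simpl /=;
      [apply: filterS FA|apply: filterS FB] => z ?; exists z.
  move=> [_ _] /= [[x Ax <-] [y By <-]].
  have /= := AB (x, y) (conj Ax By); rewrite -!ball_normE /=.
  rewrite -[`|x - y|](RRe_real (normr_real _)) ltcR.
  by apply: le_lt_trans; rewrite -raddfB ler_ImnormC.
apply/cvg_ex; exists (Complex (lim (Re @ F)) (lim (Im @ F))).
have := @cvgC _ _ FF _ _ _ _ ReF ImF.
by rewrite (_ : (fun t => _) = id) //; apply/funext; case.
Qed.

End ComplexTopology.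

HB.instance Definition _ (R : realType) :=
  Uniform_isComplete.Build R[i] (@complex_complete R).

Section DotTheory.
Variables (C : numClosedFieldType) (U : lmodType C).

Section MakeDot.
Variable op : U -> U -> C.
Hypothesis op_lin : forall v, scalar (op^~ v).
Hypothesis op_herm : forall u v, op u v = (op v u)^*.
Hypothesis op_pos : forall u, u != 0 -> 0 < op u u.

Let op_bilinear : bilinear_for (GRing.Scale.Law.clone _ _ *%R _)
  (GRing.Scale.Law.clone _ _ (Num.conj \; *%R) _) op.
Proof.
split=> [v|u] a x y /=; first exact: op_lin.
by rewrite op_herm op_lin rmorphD rmorphM /= -!(op_herm u).
Qed.

Let op_hermitian : forall u v, op u v = (-1) ^+ false * Num.conj (op v u).
Proof. by move=> u v; rewrite expr0 mul1r; exact: op_herm. Qed.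

Definition mk_dot : {dot U for @Num.conj C} :=
  HB.pack_for {dot U for @Num.conj C} op
    (bilinear_isBilinear.Build _ _ _ _ _ _ op op_bilinear)
    (isHermitianSesquilinear.Build _ _ _ _ op op_hermitian)
    (isDotProduct.Build _ _ op op_pos).

Lemma mk_dotE u v : mk_dot u v = op u v. Proof. by []. Qed.
End MakeDot.

Variable f : {dot U for @Num.conj C}.

Lemma dot_conj u v : f u v = (f v u)^*.
Proof. by rewrite hermC /= expr0 mul1r. Qed.

Lemma dot_CauchySchwarz u v : `|f u v| ^+ 2 <= f u u * f v v.
Proof.
have [->|v0] := eqVneq v 0; first by rewrite !linear0r normr0 expr0n mulr0.
have fv0 : 0 < f v v by rewrite dnorm_gt0.
rewrite -(ler_pM2r fv0) -subr_ge0.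
have := dnorm_ge0 f (f v v *: u - f u v *: v).
have -> : f (f v v *: u - f u v *: v) (f v v *: u - f u v *: v) =
   f v v * (f u u * f v v - `|f u v| ^+ 2).
  have vR : (f v v)^* = f v v by rewrite -dot_conj.
  rewrite linearBl !linearBr !linearZl_LR /= !linearZr_LR /= vR normCK.
  rewrite (dot_conj v u); ring.
by rewrite pmulr_rge0 // subr_ge0 -subr_ge0 -mulrBl pmulr_lge0.
Qed.

Lemma dot_normD u v :
  sqrtC (f (u + v) (u + v)) <= sqrtC (f u u) + sqrtC (f v v).
Proof.
have su : 0 <= sqrtC (f u u) by rewrite sqrtC_ge0 dnorm_ge0.
have sv : 0 <= sqrtC (f v v) by rewrite sqrtC_ge0 dnorm_ge0.
rewrite -(@ler_pXn2r _ 2) ?nnegrE ?sqrtC_ge0 ?dnorm_ge0 ?addr_ge0 //.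
rewrite sqrtCK sqrrD !sqrtCK dnormD addrAC lerD2r lerD2l.
have CS : `|f u v| <= sqrtC (f u u) * sqrtC (f v v).
  rewrite -(@ler_pXn2r _ 2) ?nnegrE ?mulr_ge0 // exprMn !sqrtCK.
  exact: dot_CauchySchwarz.
have dR : f u v + (f u v)^* \is Num.real.
  by rewrite CrealE rmorphD /= conjCK addrC.
apply: le_trans (real_ler_norm dR) _; apply: le_trans (ler_normD _ _) _.
by rewrite norm_conjC -mulr2n lerMn2r CS orbT.
Qed.

Lemma dot_normZ a u : sqrtC (f (a *: u) (a *: u)) = `|a| * sqrtC (f u u).
Proof.
by rewrite dnormZ sqrtCM ?nnegrE ?exprn_ge0 ?dnorm_ge0 // sqrCK.
Qed.

Lemma dot_norm0 u : sqrtC (f u u) = 0 -> u = 0.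
Proof. by move/eqP; rewrite sqrt_dnorm_eq0 => /eqP. Qed.

End DotTheory.

(* The inner product is linear in its first argument and conjugate-linear in the
   second. *)
HB.mixin Record isHilbert (R : realType) H & CompleteNormedModule R[i] H := {
  hdot_subdef : {dot H for @Num.conj R[i]};
  hnorm_subproof : forall x : H, `|x| ^+ 2 = hdot_subdef x x
}.

#[short(type="hilbertType")]
HB.structure Definition Hilbert (R : realType) :=
  {H of CompleteNormedModule R[i] H & isHilbert R H}.

Definition hdot (R : realType) (H : hilbertType R) : {dot H for @Num.conj R[i]} :=
  @hdot_subdef R H.
Arguments hdot {R H}.

Lemma hnormE (R : realType) (H : hilbertType R) (x : H) : `|x| ^+ 2 = hdot x x.
Proof. exact: hnorm_subproof. Qed.

Section ComplexSeries.
Variable R : realType.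
Local Notation C := R[i].

Lemma limC_ge (T : Type) (F : set_system T) {FF : ProperFilter F} (u : T -> C) (a l : C) :
  (\forall t \near F, a <= u t) -> u @ F --> l -> a <= l.
Proof.
move=> au ul.
suff la : `|l - a| = l - a.
  by rewrite -subr_ge0 -la normr_ge0.
have ula : (fun t => u t - a) @ F --> l - a by exact: cvgB ul (cvg_cst a).
have nula : (fun t => `|u t - a|) @ F --> `|l - a| by exact: cvg_norm.
apply: (cvg_unique (@norm_hausdorff _ C) nula).
apply: cvg_trans ula; apply: near_eq_cvg.
by apply: filterS au => t aut; rewrite ger0_norm // subr_ge0.
Qed.

Lemma limC_le (T : Type) (F : set_system T) {FF : ProperFilter F} (u : T -> C) (a l : C) :
  (\forall t \near F, u t <= a) -> u @ F --> l -> l <= a.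
Proof.
move=> au ul; rewrite -lerN2; apply: limC_ge (cvgN ul).
by apply: filterS au => t; rewrite lerN2.
Qed.

Lemma nneg_seriesP (u : nat -> C) : (forall k, 0 <= u k) ->
  cvgn (series u) <-> exists M, forall N, series u N <= M.
Proof.
move=> u0; split=> [cu|[M uM]].
  exists (limn (series u)) => N; apply: limC_ge cu.
  exists N => // m /= Nm; rewrite /series /= (big_cat_nat (leq0n _) Nm) //= lerDl.
  exact: sumr_ge0.
have sE N : series u N = (real_complex R) (series (fun k => complex.Re (u k)) N).
  rewrite /series /= rmorph_sum; apply: eq_bigr => k _; exact: ge0C.
have : cvgn (series (fun k => complex.Re (u k))).
  apply: nondecreasing_is_cvgn.
    move=> m p mp; rewrite -lecR -!sE /series /= (big_cat_nat (leq0n _) mp) //= lerDl.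
    exact: sumr_ge0.
  exists (complex.Re M) => _ [N _ <-]; have := uM N.
  by rewrite sE lecE /= => /andP[].
move=> cRe; apply/cvg_ex.
exists (Complex (limn (series (fun k => complex.Re (u k)))) 0).
rewrite (_ : series u = fun N => Complex (series (fun k => complex.Re (u k)) N) 0).
  exact: cvgC cRe (cvg_cst 0).
by apply/funext => N; rewrite sE.
Qed.

Lemma nneg_series_le (u : nat -> C) N : (forall k, 0 <= u k) ->
  cvgn (series u) -> series u N <= limn (series u).
Proof.
move=> u0 cu; apply: limC_ge cu.
exists N => // m /= Nm; rewrite /series /= (big_cat_nat (leq0n _) Nm) //= lerDl.
exact: sumr_ge0.
Qed.

Lemma dominated_series_cvg (u v : nat -> C) :
  (forall k, `|u k| <= v k) -> cvgn (series v) -> cvgn (series u).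
Proof.
move=> uv /cvg_cauchy/cauchy_seriesP cv; apply: cauchy_cvg; apply/cauchy_seriesP.
move=> e /cv; apply: filterS => -[m p] /=; apply: le_lt_trans.
apply: le_trans (ler_norm_sum _ _ _) _.
have v0 k : 0 <= v k by apply: le_trans (uv k).
by rewrite ger0_norm ?sumr_ge0 //; apply: ler_sum.
Qed.

End ComplexSeries.

Section WordSums.
Variables (n : nat) (V : nmodType).

(* A word of length k over the n letters g_1, ..., g_n (the elements of ['I_n],
   shifted by one) is a [k.-tuple 'I_n]; these index the orthonormal basis of the
   summand (C^n)^{⊗k} of the Fock space. *)
Definition level_sum (F : seq 'I_n -> V) (k : nat) : V :=
  \sum_(w : k.-tuple 'I_n) F w.

Lemma level_sum_cons F k :
  level_sum F k.+1 = \sum_(i < n) level_sum (fun w => F (i :: w)) k.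
Proof.
rewrite /level_sum pair_bigA /=.
rewrite (reindex (fun p : 'I_n * k.-tuple 'I_n => [tuple of p.1 :: p.2])) //=.
exists (fun w : k.+1.-tuple 'I_n => (thead w, [tuple of behead w])) => [[i w] _|w _] /=.
  by congr (_, _); apply: val_inj.
by rewrite -tuple_eta.
Qed.

Lemma level_sum1 F (mu : seq 'I_n) k : (forall w, w != mu -> F w = 0) ->
  level_sum F k = if k == size mu then F mu else 0.
Proof.
move=> F0; rewrite /level_sum; case: eqP => [->|kmu].
  rewrite (bigD1 (in_tuple mu)) //= big1 ?addr0 // => w wmu.
  by apply: F0; apply: contra wmu => /eqP ?; apply/eqP/val_inj.
apply: big1 => w _; apply: F0; apply: contra_notN kmu => /eqP <-.
by rewrite size_tuple.
Qed.

End WordSums.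

Section Fock.
Variables (R : realType) (n : nat) (E : hilbertType R).
Local Notation C := R[i].
Implicit Types f g : seq 'I_n -> E.

Definition square_summable f : Prop :=
  cvgn (series (level_sum (fun w => `|f w| ^+ 2)) : nat -> C).

Let lsum2_ge0 f k : 0 <= level_sum (fun w => `|f w| ^+ 2) k :> C.
Proof. by apply: sumr_ge0 => w _; rewrite exprn_ge0. Qed.

Lemma square_summableP f : square_summable f <->
  exists M : C, forall N, series (level_sum (fun w => `|f w| ^+ 2)) N <= M.
Proof. exact: nneg_seriesP. Qed.

Lemma sqr_normD_le (x y : E) : `|x + y| ^+ 2 <= 2 * `|x| ^+ 2 + 2 * `|y| ^+ 2.
Proof.
apply: le_trans (_ : (`|x| + `|y|) ^+ 2 <= _).
  by rewrite lerXn2r ?nnegrE ?addr_ge0 // ler_normD.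
rewrite -subr_ge0.
have -> : 2 * `|x| ^+ 2 + 2 * `|y| ^+ 2 - (`|x| + `|y|) ^+ 2 =
          (`|x| - `|y|) ^+ 2 :> C by ring.
by rewrite -realEsqr realB ?normr_real.
Qed.

Lemma square_summableD f g :
  square_summable f -> square_summable g -> square_summable (f \+ g).
Proof.
move=> /square_summableP[M fM] /square_summableP[M' gM'].
apply/square_summableP; exists (2 * M + 2 * M') => N.
apply: le_trans (_ : 2 * series (level_sum (fun w => `|f w| ^+ 2)) N +
   2 * series (level_sum (fun w => `|g w| ^+ 2)) N <= _).
  rewrite /series /= !mulr_sumr -big_split /=; apply: ler_sum => k _.
  rewrite /level_sum !mulr_sumr -big_split /=; apply: ler_sum => w _.
  exact: sqr_normD_le.
by rewrite lerD // ler_pM2l.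
Qed.

Lemma square_summableZ (a : C) f :
  square_summable f -> square_summable (fun w => a *: f w).
Proof.
move=> /square_summableP[M fM]; apply/square_summableP; exists (`|a| ^+ 2 * M) => N.
rewrite (_ : series _ N = `|a| ^+ 2 * series (level_sum (fun w => `|f w| ^+ 2)) N).
  by rewrite ler_wpM2l // exprn_ge0.
rewrite /series /= mulr_sumr; apply: eq_bigr => k _.
rewrite /level_sum mulr_sumr; apply: eq_bigr => w _.
by rewrite normrZ exprMn.
Qed.

Lemma square_summable0 : square_summable (fun=> 0).
Proof.
apply/square_summableP; exists 0 => N; rewrite /series /= big1 // => k _.
by rewrite /level_sum big1 // => w _; rewrite normr0 expr0n.
Qed.

(* [fock n E] is the Hilbert space F^2_n ⊗ E, realized as the space of
   square-summable E-valued families indexed by the free semigroup on n letters: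
   the family x stands for \sum_w e_w ⊗ x w. The Fock space F^2_n itself is the
   case E = C. The lemmas [hdot_ket], [tensor_linearl], [tensor_linearr],
   [hdot_tensor] and [truncation_cvg] below show that this is a Hilbert tensor
   product and that the vectors e_w ⊗ x span a dense subspace. *)
Record fock := Fock {
  fock_fun :> seq 'I_n -> E;
  fock_funP : `[< square_summable fock_fun >]
}.

HB.instance Definition _ := [isSub for fock_fun].
HB.instance Definition _ := [Choice of fock by <:].

Let fock_submod : submod_closed [pred f : seq 'I_n -> E | `[< square_summable f >]].
Proof.
split=> [|a f g /asboolP fs /asboolP gs]; apply/asboolP.
  exact: square_summable0.
exact: (square_summableD (square_summableZ (a := a) fs) gs).
Qed.

HB.instance Definition _ :=
  GRing.SubChoice_isSubLmodule.Build C (seq 'I_n -> E) _ fock fock_submod.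

Lemma fockP (x : fock) : square_summable x.
Proof. exact/asboolP/fock_funP. Qed.

Lemma fock_ext (x y : fock) : (forall w, x w = y w) -> x = y.
Proof. by move=> xy; apply: val_inj; apply/funext. Qed.

Lemma fockD (x y : fock) w : (x + y) w = x w + y w. Proof. by []. Qed.
Lemma fockN (x : fock) w : (- x) w = - x w. Proof. by []. Qed.
Lemma fockB (x y : fock) w : (x - y) w = x w - y w. Proof. by []. Qed.
Lemma fockZ a (x : fock) w : (a *: x) w = a *: x w. Proof. by []. Qed.
Lemma fock0 w : (0 : fock) w = 0. Proof. by []. Qed.
End Fock.
Arguments fockP {R n E} x [t] _.

Lemma cvg_sum0 (K : numFieldType) (V : normedModType K) (T I : Type)
    (F : set_system T) {FF : Filter F} (r : seq I) (G : I -> T -> V) :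
  (forall i, G i @ F --> 0) -> (fun t => \sum_(i <- r) G i t) @ F --> (0 : V).
Proof.
move=> G0; elim: r => [|i r IH].
  by under eq_fun do rewrite big_nil; exact: cvg_cst.
under eq_fun do rewrite big_cons.
by have := @cvgD _ _ _ _ FF _ _ _ _ (G0 i) IH; rewrite addr0.
Qed.

Section FockDot.
Variables (R : realType) (n : nat) (E : hilbertType R).
Local Notation C := R[i].
Local Notation F := (fock n E).
Implicit Types x y z : F.

Definition fock_dot x y : C := limn (series (level_sum (fun w => hdot (x w) (y w)))).

Lemma fock_dot_cvg x y :
  series (level_sum (fun w => hdot (x w) (y w))) @ \oo --> fock_dot x y.
Proof.
apply: (@dominated_series_cvg R _
  (level_sum (fun w => `|x w| ^+ 2) \+ level_sum (fun w => `|y w| ^+ 2))).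
  move=> k; rewrite /level_sum /= -big_split /=.
  apply: le_trans (ler_norm_sum _ _ _) _; apply: ler_sum => w _.
  have xy : `|hdot (x w) (y w)| <= `|x w| * `|y w|.
    rewrite -(@ler_pXn2r _ 2) ?nnegrE ?mulr_ge0 // exprMn !hnormE.
    exact: dot_CauchySchwarz.
  apply: le_trans xy _; rewrite -subr_ge0.
  have -> : `|x w| ^+ 2 + `|y w| ^+ 2 - `|x w| * `|y w| =
     ((`|x w| - `|y w|) ^+ 2 + `|x w| ^+ 2 + `|y w| ^+ 2) / 2 :> C.
    by field.
  have sq : 0 <= (`|x w| - `|y w|) ^+ 2 by rewrite -realEsqr realB ?normr_real.
  by rewrite divr_ge0 // !addr_ge0 // exprn_ge0.
rewrite seriesD; apply: is_cvgD; exact: fockP.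
Qed.

Lemma fock_dot_eq x y l :
  series (level_sum (fun w => hdot (x w) (y w))) @ \oo --> (l : C) ->
  fock_dot x y = l.
Proof. by apply: cvg_lim; exact: norm_hausdorff. Qed.

Lemma fock_dotxx x :
  fock_dot x x = limn (series (level_sum (fun w => `|x w| ^+ 2)) : nat -> C).
Proof.
rewrite /fock_dot (_ : (fun w => _) = (fun w => `|x w| ^+ 2)) //.
by apply/funext => w; rewrite hnormE.
Qed.

Let lin y : scalar (fock_dot^~ y).
Proof.
move=> a x z /=; apply: fock_dot_eq.
rewrite (_ : series _ =
   (fun N => a *: series (level_sum (fun w => hdot (x w) (y w))) N
     + series (level_sum (fun w => hdot (z w) (y w))) N)).
  by apply: cvgD; [apply: cvgZr|]; exact: fock_dot_cvg.
apply/funext => N; rewrite /series /= scaler_sumr -big_split /=.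
apply: eq_bigr => k _; rewrite /level_sum scaler_sumr -big_split /=.
by apply: eq_bigr => w _; rewrite linearPl.
Qed.

Let herm x y : fock_dot x y = (fock_dot y x)^*.
Proof.
apply: fock_dot_eq; apply/cvgrPdist_lt => e e0.
have /cvgrPdist_lt /(_ _ e0) := @fock_dot_cvg y x.
apply: filterS => N; rewrite -norm_conjC rmorphB /=.
rewrite (_ : (series _ N)^* = series (level_sum (fun w => hdot (x w) (y w))) N) //.
rewrite /series /= rmorph_sum; apply: eq_bigr => k _.
rewrite /level_sum rmorph_sum; apply: eq_bigr => w _.
by rewrite [RHS]dot_conj.
Qed.

Lemma level_normsq_ge0 x k : 0 <= level_sum (fun w => `|x w| ^+ 2) k :> C.
Proof. by apply: sumr_ge0 => w _; rewrite exprn_ge0. Qed.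

Lemma fock_dot_ge x N :
  series (level_sum (fun w => `|x w| ^+ 2)) N <= fock_dot x x :> C.
Proof.
by rewrite fock_dotxx; apply: nneg_series_le; [exact: level_normsq_ge0|exact: fockP].
Qed.

Lemma fock_dot_coord x w : `|x w| ^+ 2 <= fock_dot x x.
Proof.
apply: (le_trans _ (fock_dot_ge x (size w).+1)).
rewrite /series /= big_nat_recr //= -[leLHS]add0r lerD ?sumr_ge0 //.
  by move=> k _; exact: level_normsq_ge0.
rewrite /level_sum (bigD1 (in_tuple w)) //= lerDl sumr_ge0 // => v _.
exact: exprn_ge0.
Qed.

Let pos x : x != 0 -> 0 < fock_dot x x.
Proof.
move=> x0; have [w xw] : exists w, x w != 0.
  apply: contrapT => /forallNP x0'; move/eqP: x0; apply.
  by apply: fock_ext => w; apply/eqP; have /negP := x0' w; rewrite negbK.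
by apply: lt_le_trans (fock_dot_coord x w); rewrite exprn_gt0 // normr_gt0.
Qed.

Definition fock_hdot : {dot F for @Num.conj C} := mk_dot lin herm pos.

Lemma fock_hdotE x y : fock_hdot x y = fock_dot x y. Proof. by []. Qed.

HB.instance Definition _ := Lmodule_isNormed.Build C F
  (dot_normD fock_hdot) (dot_normZ fock_hdot) (@dot_norm0 _ _ fock_hdot).

Lemma fock_normE x : `|x| = sqrtC (fock_dot x x). Proof. by []. Qed.

Lemma fock_normsq x : `|x| ^+ 2 = fock_dot x x.
Proof. by rewrite fock_normE sqrtCK. Qed.

Lemma fock_normsq_ge x N :
  series (level_sum (fun w => `|x w| ^+ 2)) N <= `|x| ^+ 2 :> C.
Proof. by rewrite fock_normsq fock_dot_ge. Qed.

Lemma fock_normsq_le x (M : C) :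
  (forall N, series (level_sum (fun w => `|x w| ^+ 2)) N <= M) -> `|x| ^+ 2 <= M.
Proof.
move=> xM; rewrite fock_normsq fock_dotxx; have h : \forall N \near \oo, series (level_sum (fun w => `|x w| ^+ 2)) N <= M by exact: nearW.
exact: (limC_le h (fockP x)).
Qed.

Lemma fock_coord_le x w : `|x w| <= `|x|.
Proof.
by rewrite -(@ler_pXn2r _ 2) ?nnegrE // fock_normsq fock_dot_coord.
Qed.

Let complete (G : set_system F) : ProperFilter G -> cauchy G -> cvg G.
Proof.
move=> FG /cauchy_ballP cG.
have cw w : cvg ((fun x : F => x w) @ G).
  apply: cauchy_cvg; apply/cauchy_ballP => e /cG [[A B]] /= [GA GB] AB.
  exists ((fun x : F => x w) @` A, (fun x : F => x w) @` B).
    by split => /=; rewrite nbhs_simpl /=;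
      [apply: filterS GA|apply: filterS GB] => x ?; exists x.
  move=> [_ _] /= [[x Ax <-] [y By <-]].
  have /= := AB (x, y) (conj Ax By); rewrite -!ball_normE /=.
  by apply: le_lt_trans; rewrite -fockB fock_coord_le.
pose f w := lim ((fun x : F => x w) @ G).
have key e : 0 < e -> \forall x \near G,
    forall N, series (level_sum (fun w => `|(x : F) w - f w| ^+ 2)) N <= 4 * e ^+ 2 :> C.
  move=> e0; have [[A B] /= [GA GB] AB] := cG _ e0.
  apply: filterS GA => x Ax N.
  have lim0 : (fun y : F => series (level_sum (fun w => `|y w - f w| ^+ 2)) N : C)
      @ G --> (0 : C).
    apply: cvg_sum0 => k; apply: cvg_sum0 => w.
    have h : (fun y : F => `|y w - f w|) @ G --> (0 : C).
      rewrite -(normr0 E) -[X in `|X|](subrr (f w)); apply: cvg_norm.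
      by apply: cvgB; [exact: cw|exact: cvg_cst].
    by rewrite -(mulr0 (0 : C)); exact: (cvgM h h).
  have e2 : 0 < e ^+ 2 by rewrite exprn_gt0.
  have near_e := @cvgr0_norm_le _ _ _ G FG _ lim0 _ e2.
  have [y [By ye]] := filter_ex (filterI GB near_e).
  have xy : `|x - y| < e by have /= := AB (x, y) (conj Ax By); rewrite -ball_normE.
  apply: le_trans (_ : 2 * series (level_sum (fun w => `|(x - y) w| ^+ 2)) N +
     2 * series (level_sum (fun w => `|y w - f w| ^+ 2)) N <= _).
    rewrite /series /= !mulr_sumr -big_split /=; apply: ler_sum => k _.
    rewrite /level_sum !mulr_sumr -big_split /=; apply: ler_sum => w _.
    by rewrite (_ : x w - f w = (x - y) w + (y w - f w)) ?sqr_normD_le // fockB addrA subrK.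
  rewrite (_ : 4 * e ^+ 2 = 2 * e ^+ 2 + 2 * e ^+ 2); last by ring.
  apply: lerD; rewrite ler_pM2l //.
    apply: le_trans (fock_normsq_ge _ _) _.
    by rewrite lerXn2r ?nnegrE // ?ltW.
  apply: le_trans ye; rewrite ger0_norm // /series /= sumr_ge0 // => k _.
  by apply: sumr_ge0 => w _; rewrite exprn_ge0.
have fP : `[< square_summable f >].
  have [x xf] := filter_ex (key 1 ltr01).
  have xfs : square_summable (fun w => x w - f w).
    by apply/square_summableP; exists (4 * 1 ^+ 2).
  apply/asboolP; rewrite (_ : f = x \+ (fun w => - 1 *: (x w - f w))).
    exact: square_summableD (fockP x) (square_summableZ xfs).
  by apply/funext => w /=; rewrite scaleN1r opprB addrC subrK.
apply/cvg_ex; exists (Fock fP); apply/cvgrPdist_le => e e0.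
have e2 : 0 < e / 2 by rewrite divr_gt0.
apply: filterS (key _ e2) => x xf.
rewrite distrC -(@ler_pXn2r _ 2) ?nnegrE ?(ltW e0) //.
apply: fock_normsq_le => N; have := xf N.
by rewrite expr_div_n (_ : 4 * (e ^+ 2 / 2 ^+ 2) = e ^+ 2) //; field.
Qed.

HB.instance Definition _ := Uniform_isComplete.Build F complete.
Let normsq x : `|x| ^+ 2 = fock_hdot x x. Proof. exact: fock_normsq. Qed.
HB.instance Definition _ := isHilbert.Build R F normsq.

Lemma fock_hdot_def x y :
  hdot x y = limn (series (level_sum (fun w => hdot (x w) (y w)))).
Proof. by []. Qed.
End FockDot.

Section ComplexHilbert.
Variable R : realType.
Local Notation C := R[i].

Let cdot (x y : C) : C := x * Num.conj y.

Let lin y : scalar (cdot^~ y).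
Proof. by move=> a x z; rewrite /cdot mulrDl mulrA. Qed.

Let herm x y : cdot x y = Num.conj (cdot y x).
Proof. by rewrite /cdot rmorphM /= conjCK mulrC. Qed.

Let pos x : x != 0 -> 0 < cdot x x.
Proof. by move=> x0; rewrite /cdot -normCK exprn_gt0 // normr_gt0. Qed.

Let dotC : {dot C for @Num.conj C} := mk_dot lin herm pos.

Let normsq (x : C) : `|x| ^+ 2 = dotC x x. Proof. exact: normCK. Qed.

HB.instance Definition _ := isHilbert.Build R C normsq.

Lemma complex_hdotE (x y : C) : hdot x y = x * Num.conj y.
Proof. by []. Qed.

End ComplexHilbert.

Section Subspaces.
Variables (R : realType) (H : hilbertType R).
Local Notation C := R[i].

Record closed_subspace := ClosedSubspace {
  csub_set :> H -> Prop;
  csub0 : csub_set 0;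
  csub_lin : forall (a : C) x y,
    csub_set x -> csub_set y -> csub_set (a *: x + y);
  csub_closed : closed csub_set
}.

Variable S : closed_subspace.

(* A closed subspace as a Hilbert space in its own right. *)
Record csub_type := CSub { csub_val :> H; csub_valP : `[< S csub_val >] }.

HB.instance Definition _ := [isSub for csub_val].
HB.instance Definition _ := [Choice of csub_type by <:].

Let submod : submod_closed [pred x | `[< S x >]].
Proof.
split=> [|a x y /asboolP Sx /asboolP Sy]; apply/asboolP; first exact: csub0.
exact: csub_lin.
Qed.

HB.instance Definition _ :=
  GRing.SubChoice_isSubLmodule.Build C H _ csub_type submod.

Lemma csub_inS (x : csub_type) : S x. Proof. exact/asboolP/csub_valP. Qed.

Definition csub_of (x : H) (Sx : S x) : csub_type := CSub (introT (asboolP _) Sx).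

Let lin (y : csub_type) : scalar (fun x : csub_type => hdot (x : H) (y : H)).
Proof. by move=> a x z /=; rewrite linearPl. Qed.

Let herm (x y : csub_type) : hdot (x : H) (y : H) = Num.conj (hdot (y : H) (x : H)).
Proof. exact: dot_conj. Qed.

Let pos (x : csub_type) : x != 0 -> 0 < hdot (x : H) (x : H).
Proof. by move=> x0; rewrite dnorm_gt0. Qed.

Definition csub_hdot : {dot csub_type for @Num.conj C} := mk_dot lin herm pos.

Let normD (x y : csub_type) : `|((x + y : csub_type) : H)| <= `|x : H| + `|y : H|.
Proof. exact: ler_normD. Qed.
Let normZ a (x : csub_type) : `|((a *: x : csub_type) : H)| = `|a| * `|x : H|.
Proof. exact: normrZ. Qed.
Let norm0 (x : csub_type) : `|x : H| = 0 -> x = 0.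
Proof. by move=> /normr0_eq0 x0; apply: val_inj. Qed.

HB.instance Definition _ := Lmodule_isNormed.Build C csub_type normD normZ norm0.

Let complete (G : set_system csub_type) : ProperFilter G -> cauchy G -> cvg G.
Proof.
move=> FG /cauchy_ballP cG.
have cH : cvg (csub_val @ G).
  apply: cauchy_cvg; apply/cauchy_ballP => e /cG [[A B]] /= [GA GB] AB.
  exists (csub_val @` A, csub_val @` B).
    by split => /=; rewrite nbhs_simpl /=;
      [apply: filterS GA|apply: filterS GB] => x ?; exists x.
  move=> [_ _] /= [[x Ax <-] [y By <-]].
  by have /= := AB (x, y) (conj Ax By); rewrite -!ball_normE.
have Sl : S (lim (csub_val @ G)).
  apply: (closed_cvg (S : set H) (@csub_closed S) _ _ cH).
  by apply: nearW => x; exact: csub_inS.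
apply/cvg_ex; exists (csub_of Sl); apply/cvgrPdist_lt => e e0.
by have /cvgrPdist_lt /(_ _ e0) := cH.
Qed.

HB.instance Definition _ := Uniform_isComplete.Build csub_type complete.

Let normsq (x : csub_type) : `|x| ^+ 2 = csub_hdot x x.
Proof. exact: hnormE. Qed.

HB.instance Definition _ := isHilbert.Build R csub_type normsq.

Lemma csub_hdotE (x y : csub_type) : hdot x y = hdot (x : H) (y : H).
Proof. by []. Qed.
Lemma csub_normE (x : csub_type) : `|x| = `|x : H|.
Proof. by []. Qed.

Definition sub_restrict (T : H -> H) (TS : forall x, S x -> S (T x))
  (x : csub_type) : csub_type := csub_of (TS _ (csub_inS x)).

End Subspaces.
Arguments csub_inS {R H S} x.

Section Tensor.
Variables (R : realType) (n : nat).
Local Notation C := R[i].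

Let ket_ss (mu : seq 'I_n) : `[< square_summable (fun w => (w == mu)%:R : C) >].
Proof.
apply/asboolP/square_summableP; exists 1 => N.
have l1 k : level_sum (fun w : seq 'I_n => `|(w == mu)%:R : C| ^+ 2) k =
    (k == size mu)%:R.
  rewrite (@level_sum1 _ _ _ mu) => [|w /negPf ->].
    by rewrite eqxx normr1 expr1n; case: eqP.
  by rewrite normr0 expr0n.
rewrite /series /=; under eq_bigr do rewrite l1.
rewrite big_mkord; case: (ltnP (size mu) N) => [muN|Nmu].
  rewrite (bigD1 (Ordinal muN)) //= eqxx big1 ?addr0 // => k.
  by rewrite -val_eqE /= => /negPf ->.
rewrite big1 ?ler01 // => k _; case: eqP => // kmu.
by have := ltn_ord k; rewrite kmu ltnNge Nmu.
Qed.

(* [ket mu] is e_mu, with [ket [::]] the vacuum vector. *)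
Definition ket (mu : seq 'I_n) : fock n C := Fock (ket_ss mu).

Lemma ketE mu w : ket mu w = (w == mu)%:R. Proof. by []. Qed.

Variable E : hilbertType R.

Let tensor_ss (f : fock n C) (x : E) : `[< square_summable (fun w => f w *: x) >].
Proof.
have /square_summableP [M fM] := fockP f.
apply/asboolP/square_summableP; exists (M * `|x| ^+ 2) => N.
rewrite (_ : series _ N = series (level_sum (fun w => `|f w| ^+ 2)) N * `|x| ^+ 2).
  by rewrite ler_wpM2r // exprn_ge0.
rewrite /series /= mulr_suml; apply: eq_bigr => k _.
rewrite /level_sum mulr_suml; apply: eq_bigr => w _.
by rewrite normrZ exprMn.
Qed.

Definition tensor (f : fock n C) (x : E) : fock n E := Fock (tensor_ss f x).

End Tensor.
Notation "f ⊗ x" := (tensor f x) (at level 40, left associativity) : ring_scope.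

Section TensorTheory.
Variables (R : realType) (n : nat) (E : hilbertType R).
Local Notation C := R[i].

Lemma tensorE (f : fock n C) (x : E) w : (f ⊗ x) w = f w *: x.
Proof. by []. Qed.

Lemma tensor_linearl (x : E) : linear (fun f : fock n C => f ⊗ x).
Proof.
move=> a f g; apply: fock_ext => w.
by rewrite fockD fockZ !tensorE fockD fockZ scalerDl scalerA.
Qed.

Lemma tensor_linearr (f : fock n C) : linear (fun x : E => f ⊗ x).
Proof.
move=> a x y; apply: fock_ext => w.
by rewrite fockD fockZ !tensorE scalerDr !scalerA mulrC.
Qed.

Lemma hdot_tensor (f g : fock n C) (x y : E) :
  hdot (f ⊗ x) (g ⊗ y) = hdot f g * hdot x y.
Proof.
rewrite fock_hdot_def; apply: cvg_lim; first exact: norm_hausdorff.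
rewrite (_ : series _ = (fun N =>
   series (level_sum (fun w => hdot (f w) (g w))) N * hdot x y)).
  by apply: cvgM; [exact: fock_dot_cvg|exact: cvg_cst].
apply/funext => N; rewrite /series /= mulr_suml; apply: eq_bigr => k _.
rewrite /level_sum mulr_suml; apply: eq_bigr => w _.
by rewrite linearZl_LR linearZr_LR /= mulrA.
Qed.

Lemma hdot_ket (mu nu : seq 'I_n) : hdot (ket R mu) (ket R nu) = (mu == nu)%:R.
Proof.
rewrite fock_hdot_def; apply: cvg_lim; first exact: norm_hausdorff.
apply/cvgrPdist_lt => e e0; exists (size mu).+1 => // N /= muN.
rewrite (_ : series _ N = (mu == nu)%:R) ?subrr ?normr0 //.
have l1 k : level_sum (fun w => hdot (ket R mu w) (ket R nu w)) k =
    if k == size mu then (mu == nu)%:R else 0 :> C.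
  rewrite (@level_sum1 _ _ _ mu) => [|w /negPf wmu].
    by rewrite complex_hdotE !ketE eqxx mul1r conjC_nat.
  by rewrite complex_hdotE !ketE wmu mul0r.
rewrite /series /=; under eq_bigr do rewrite l1.
rewrite big_mkord (bigD1 (Ordinal muN)) //= eqxx big1 ?addr0 // => k.
by rewrite -val_eqE /= => /negPf ->.
Qed.

Definition truncation (x : fock n E) (N : nat) : fock n E :=
  \sum_(0 <= k < N) level_sum (fun w => ket R w ⊗ x w) k.

Lemma truncationE (x : fock n E) N w :
  truncation x N w = if (size w < N)%N then x w else 0.
Proof.
have sumE I (r : seq I) (G : I -> fock n E) :
    (\sum_(i <- r) G i) w = \sum_(i <- r) G i w.
  by apply: (big_morph (fun y : fock n E => y w)).
rewrite /truncation sumE.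
have lE k : level_sum (fun v => ket R v ⊗ x v) k w = if k == size w then x w else 0.
  rewrite /level_sum sumE.
  rewrite -[LHS]/(level_sum (fun v => (ket R v ⊗ x v) w) k) (@level_sum1 _ _ _ w).
    by rewrite tensorE ketE eqxx scale1r.
  by move=> v; rewrite eq_sym tensorE ketE => /negPf ->; rewrite scale0r.
under eq_bigr do rewrite lE.
rewrite big_mkord; case: ltnP => [wN|Nw].
  rewrite (bigD1 (Ordinal wN)) //= eqxx big1 ?addr0 // => k.
  by rewrite -val_eqE /= => /negPf ->.
rewrite big1 // => k _; case: eqP => // kw.
by have := ltn_ord k; rewrite kw ltnNge Nw.
Qed.

Lemma truncation_cvg (x : fock n E) : truncation x @ \oo --> x.
Proof.
pose s N : C := series (level_sum (fun w => `|x w| ^+ 2)) N.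
have sx : s @ \oo --> `|x| ^+ 2.
  by rewrite fock_normsq fock_dotxx; exact: fockP.
have le_diff N : `|x - truncation x N| ^+ 2 <= `|x| ^+ 2 - s N.
  apply: fock_normsq_le => M.
  have lE k : level_sum (fun w => `|(x - truncation x N) w| ^+ 2) k =
      if (k < N)%N then 0 else level_sum (fun w => `|x w| ^+ 2) k :> C.
    rewrite /level_sum; under eq_bigr => w _ do
      rewrite fockB truncationE size_tuple.
    case: ifP => _; last by under eq_bigr do rewrite subr0.
    by rewrite big1 // => w _; rewrite subrr normr0 expr0n.
  rewrite /series /=; under eq_bigr do rewrite lE.
  have [MN|NM] := leqP M N.
    rewrite big_nat big1 ?subr_ge0 ?fock_normsq_ge // => k /andP[_ kM].
    by rewrite (leq_trans kM MN).
  rewrite (big_cat_nat (leq0n N) (ltnW NM)) /= big_nat big1; last first.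
    by move=> k /andP[_ ->].
  rewrite add0r lerBrDl; apply: le_trans (fock_normsq_ge x M).
  rewrite /s /series /= (big_cat_nat (leq0n N) (ltnW NM)) /= lerD2l.
  rewrite big_nat [leRHS]big_nat; apply: ler_sum => k /andP[Nk _].
  by rewrite ltnNge Nk.
apply/cvgrPdist_lt => e e0.
have e2 : 0 < e ^+ 2 by rewrite exprn_gt0.
have /cvgrPdist_lt /(_ _ e2) := sx.
apply: filterS => N sN; rewrite -(@ltr_pXn2r _ 2) ?nnegrE ?(ltW e0) //.
apply: le_lt_trans (le_diff N) _; apply: le_lt_trans sN.
by rewrite ger0_norm // subr_ge0 fock_normsq_ge.
Qed.

End TensorTheory.

Section Creation.
Variables (R : realType) (n : nat).
Local Notation C := R[i].

Section Def.
Variable E : hilbertType R.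

Definition creation_fun (i : 'I_n) (f : seq 'I_n -> E) (w : seq 'I_n) : E :=
  if w is j :: v then if j == i then f v else 0 else 0.

Let creation_ss i (x : fock n E) : `[< square_summable (creation_fun i x) >].
Proof.
have /square_summableP [M xM] := fockP x.
apply/asboolP/square_summableP; exists M => N; apply: le_trans (xM N).
case: N => [|N]; first by rewrite /series /= !big_geq.
have l0 : level_sum (fun w => `|creation_fun i x w| ^+ 2) 0 = 0 :> C.
  by rewrite /level_sum big1 // => w _; rewrite tuple0 /= normr0 expr0n.
have lS k : level_sum (fun w => `|creation_fun i x w| ^+ 2) k.+1 =
    level_sum (fun w => `|x w| ^+ 2) k :> C.
  rewrite level_sum_cons (bigD1 i) //= big1 ?addr0.
    by apply: eq_bigr => w _; rewrite eqxx.
  move=> j /negPf ji; rewrite /level_sum big1 // => w _.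
  by rewrite ji normr0 expr0n.
rewrite /series /= big_nat_recl // l0 add0r.
under eq_bigr do rewrite lS.
by rewrite big_nat_recr //= lerDl level_normsq_ge0.
Qed.

(* [creation i] is S_i ⊗ I_E, see [creation_ket] and [creation_tensor]; on
   [fock n R[i]] it is S_i itself. *)
Definition creation i (x : fock n E) : fock n E := Fock (creation_ss i x).

Lemma creationE i x w :
  creation i x w = if w is j :: v then if j == i then x v else 0 else 0.
Proof. by []. Qed.

Let creation_linear i : linear (creation i).
Proof.
move=> a x y; apply: fock_ext => -[|j v]; rewrite fockD fockZ !creationE.
  by rewrite scaler0 addr0.
by case: eqP => _; rewrite ?fockD ?fockZ // scaler0 addr0.
Qed.

HB.instance Definition _ i :=
  GRing.isLinear.Build C (fock n E) (fock n E) _ (creation i) (creation_linear i).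
End Def.

Lemma creation_ket i (mu : seq 'I_n) : creation i (ket R mu) = ket R (i :: mu).
Proof.
apply: fock_ext => -[|j v]; rewrite creationE !ketE ?eqseq_cons //.
by case: eqP.
Qed.

Lemma creation_tensor (E : hilbertType R) i (f : fock n C) (x : E) :
  creation i (f ⊗ x) = creation i f ⊗ x.
Proof.
apply: fock_ext => -[|j v]; rewrite tensorE !creationE ?scale0r //.
by case: eqP => _; rewrite ?tensorE ?scale0r.
Qed.

End Creation.

Definition separable (T : topologicalType) : Prop :=
  exists D : set T, countable D /\ dense D.

Section Operators.
Variable R : realType.

Definition bounded_operator (H K : hilbertType R) (T : H -> K) : Prop :=
  exists M : R[i], forall x, `|T x| <= M * `|x|.

Definition unitary (H K : hilbertType R) (U : H -> K) : Prop :=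
  (forall x y, hdot (U x) (U y) = hdot x y) /\ (forall y, exists x, U x = y).

Definition unitarily_equivalent (I : Type) (H K : hilbertType R)
    (A : I -> H -> H) (B : I -> K -> K) : Prop :=
  exists U : {linear H -> K},
    unitary U /\ forall i x, U (A i x) = B i (U x).

Definition invariant_subspace (H : hilbertType R) (S : closed_subspace H) (T : H -> H) :
  Prop := forall x, S x -> S (T x).

(* The tuple (W, T_1, ..., T_n), with W at index 0. *)
Definition op_tuple (n : nat) (H : Type) (W : H -> H) (T : 'I_n -> H -> H)
  (k : 'I_n.+1) : H -> H := oapp T W (unlift ord0 k).

End Operators.

Section Odometer.
Variables (R : realType) (n : nat) (n_gt0 : (0 < n)%N).

Definition first_letter : 'I_n := Ordinal n_gt0.
Definition last_letter : 'I_n := Ordinal (etrans (ltn_predL n) n_gt0).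

(* [W] takes the values prescribed for W_L on the vectors e_mu ⊗ eta. Since these
   span a dense subspace, a bounded linear [W] with this property is the bounded
   extension of W_L. *)
Definition odometer_map (E : hilbertType R) (L : E -> fock n E)
    (W : fock n E -> fock n E) : Prop :=
  [/\ forall eta, W (ket R [::] ⊗ eta) = L eta,
      forall (m : nat) eta, (0 < m)%N ->
        W (ket R (nseq m last_letter) ⊗ eta)
          = iter m (creation first_letter) (L eta)
    & forall (j : nat) (i i' : 'I_n) (nu : seq 'I_n) eta, i' = i.+1 :> nat ->
        W (ket R (nseq j last_letter ++ i :: nu) ⊗ eta)
          = ket R (nseq j first_letter ++ i' :: nu) ⊗ eta].

Definition odometer_representation (H : hilbertType R) (W : H -> H)
    (T : 'I_n -> H -> H) : Prop :=
  (forall i i' : 'I_n, i' = i.+1 :> nat -> forall x, W (T i x) = T i' x) /\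
  (forall x, W (T last_letter x) = T first_letter (W x)).

(* (W_L, S^E) is a Fock representation, with [W] the bounded operator W_L. *)
Definition fock_representation (E : hilbertType R) (L : {linear E -> fock n E})
    (W : {linear fock n E -> fock n E}) : Prop :=
  [/\ bounded_operator L, bounded_operator W, odometer_map L W
    & odometer_representation W (@creation R n E)].

End Odometer.

(* Main.v *)
(* A Wold decomposition. The restrictions T_i of the creation operators to S are
   isometries with orthogonal ranges. With A_i the adjoint of T_i, the wandering
   subspace K is the intersection of the kernels of the A_i, and
   P = 1 - \sum_i T_i A_i projects onto it. The map U sending x to the family
   w |-> P A_w x intertwines T_i with S_i ⊗ I_K, and
   |x|^2 = \sum_(|w| < N) |P A_w x|^2 + |r_N|^2 with r_N = \sum_(|w| = N) T_w A_w x.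
   The vector r_N vanishes on the words of length less than N and satisfies
   <x, r_N> = |r_N|^2, so |r_N| is at most the norm of the tail of x beyond length N,
   which tends to 0. Hence U is isometric; its range is closed and contains every
   e_w ⊗ p with p in K, so U is unitary. Transporting W by U gives a bounded
   operator satisfying the odometer relations with S^K, and those relations force it
   to be the odometer map of its restriction to the vacuum vectors. *)
Require Import Defs.
From HB Require Import structures.
From mathcomp Require Import all_boot all_order all_algebra.
From mathcomp Require Import complex ring.
From mathcomp Require Import boolp classical_sets cardinality reals.
From mathcomp Require Import topology normedtype sequences.

Set Implicit Arguments.
Unset Strict Implicit.
Unset Printing Implicit Defensive.
Import Order.TTheory GRing.Theory Num.Theory numFieldNormedType.Exports.
Local Open Scope ring_scope.

(** * Limits and closedness in normed spaces over the complex numbers *)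

Section Approximation.
Variable R : realType.
Local Notation C := R[i].

Lemma invSn_lt (e : C) : 0 < e -> exists k : nat, k.+1%:R^-1 < e.
Proof.
move=> /gt0C[d d0 ->]; exists (Num.truncn d^-1).
rewrite -(rmorph_nat (real_complex R)) -fmorphV ltcR.
by rewrite -[ltRHS]invrK ltf_pV2 ?posrE ?invr_gt0 ?ltr0Sn // truncnS_gt.
Qed.

(* [Q k] is the set of approximate solutions of precision k; they accumulate at a
   single point. *)
Lemma cauchy_approx_limit (H : completeNormedModType C) (Q : nat -> H -> Prop) :
  (forall j k x, (j <= k)%N -> Q k x -> Q j x) ->
  (forall k, exists x, Q k x) ->
  (forall e : C, 0 < e ->
     exists k, forall x y, Q k x -> Q k y -> `|x - y| < e) ->
  exists l, forall (e : C) k, 0 < e -> exists2 x, Q k x & `|l - x| < e.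
Proof.
move=> Qmono Qex Qcauchy.
have QF : ProperFilter (filter_from [set: nat]%classic (fun k => [set x | Q k x]%classic)).
  apply: filter_from_proper => [|k _]; last exact: Qex.
  apply: filter_from_filter; first by exists 0%N.
  move=> j k _ _; exists (maxn j k) => // x /= Qx.
  by split; apply: Qmono Qx; rewrite ?leq_maxl ?leq_maxr.
have : cvg (filter_from [set: nat]%classic (fun k => [set x | Q k x]%classic)).
  apply: cauchy_cvg; apply/cauchy_ballP => e e0.
  have [k Qk] := Qcauchy e e0.
  exists ([set x | Q k x], [set x | Q k x])%classic; first by split; exists k.
  by move=> [x y] /= [Qx Qy]; rewrite -ball_normE /=; exact: Qk.
set l := lim _ => Ql; exists l => e k e0.
have [j _ jl] : filter_from [set: nat]%classic (fun k => [set x | Q k x]%classic) (ball l e).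
  by apply: Ql; exact: nbhsx_ballx.
(* Precision [maxn j k] puts [x] in [Q k] and, through [Q j], in the ball around [l]. *)
have [x Qx] := Qex (maxn j k); exists x.
  by apply: Qmono Qx; rewrite leq_maxr.
have := jl x; rewrite -ball_normE; apply.
by apply: Qmono Qx; rewrite leq_maxl.
Qed.

Lemma norm_closedP (V : normedModType C) (A : set V) :
  closed A <->
  forall x, (forall e : C, 0 < e -> exists2 y, A y & `|x - y| < e) -> A x.
Proof.
split=> [Acl x xA|Aapprox x xA].
  apply: Acl => B /nbhs_ballP[e e0 eB].
  have [y Ay xy] := xA e e0; exists y; split=> //.
  by apply: eB; rewrite -ball_normE.
apply: Aapprox => e e0.
have [y [Ay xy]] := xA _ (nbhsx_ballx x e e0).
by exists y => //; move: xy; rewrite -ball_normE.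
Qed.

Lemma norm_lt_eq0 (V : normedModType C) (x : V) :
  (forall e : C, 0 < e -> `|x| < e) -> x = 0.
Proof.
move=> xe; apply/eqP/contraT => x0.
by have := xe _ (_ : 0 < `|x|); rewrite normr_gt0 ltxx => /(_ x0).
Qed.

Lemma lipschitz_preimage_closed (V W : normedModType C) (f : V -> W) (M : C)
    (A : set W) : (forall x y, `|f x - f y| <= M * `|x - y|) ->
  closed A -> closed (f @^-1` A)%classic.
Proof.
move=> fM /norm_closedP Acl; apply/norm_closedP => x xA; apply: Acl => e e0.
have M0 : 0 <= `|M| + 1 by rewrite addr_ge0.
have M0' : 0 < `|M| + 1 by rewrite ltr_wpDl.
have [y Ay xy] := xA (e / (`|M| + 1)) (divr_gt0 e0 M0').
exists (f y) => //; have := fM x y; set a := `|x - y| in xy *.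
have [a0 _|a0] := eqVneq a 0.
  suff -> : x = y by rewrite subrr normr0.
  by apply/eqP; rewrite -subr_eq0 -normr_eq0 -/a a0.
have a_gt0 : 0 < a by rewrite lt_neqAle eq_sym a0 normr_ge0.
move=> fxy; apply: le_lt_trans (_ : (`|M| + 1) * a < e); last first.
  by rewrite mulrC -ltr_pdivlMr.
(* [M] is an arbitrary complex number; the Lipschitz bound makes [M * a] nonnegative, hence equal to
   its modulus [|M| * a]. *)
have Ma0 : 0 <= M * a by apply: le_trans fxy; exact: normr_ge0.
apply: le_trans fxy _; rewrite -[M * a]ger0_norm // normrM (ger0_norm (ltW a_gt0)).
by rewrite ler_pM2r // lerDl.
Qed.

End Approximation.

(** * Orthogonal projection onto closed subspaces *)

Section HilbertGeometry.
Variables (R : realType) (H : hilbertType R).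
Local Notation C := R[i].
Implicit Types x y z : H.

Lemma hdot_normM x y : `|hdot x y| <= `|x| * `|y|.
Proof.
rewrite -(@ler_pXn2r _ 2) ?nnegrE ?mulr_ge0 // exprMn (hnormE x) (hnormE y).
exact: dot_CauchySchwarz.
Qed.

Lemma hnorm_pythagoras x y : hdot x y = 0 -> `|x + y| ^+ 2 = `|x| ^+ 2 + `|y| ^+ 2.
Proof. by move=> xy0; rewrite !hnormE dnormD /= xy0 conjC0 !addr0. Qed.

Lemma hnorm_parallelogram x y :
  `|x + y| ^+ 2 + `|x - y| ^+ 2 = 2 * `|x| ^+ 2 + 2 * `|y| ^+ 2.
Proof.
have := dnormD hdot x (- y); have := dnormD hdot x y; rewrite /= !hnormE => -> ->.
rewrite linearNr linearNl linearNr rmorphN opprK; ring.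
Qed.

Lemma hdot_ext x y : (forall z, hdot x z = hdot y z) -> x = y.
Proof.
move=> xy; apply/eqP; rewrite -subr_eq0; apply/eqP; apply: (@dot_norm0 _ _ hdot).
by rewrite linearBl /= xy subrr sqrtC0.
Qed.

(** By Cauchy-Schwarz the functional [hdot^~ y] is Lipschitz with constant [|y|]. *)
Lemma hdot_eq0_closed (y : H) : closed [set x | hdot x y = 0]%classic.
Proof.
have -> : [set x | hdot x y = 0]%classic = ((hdot^~ y) @^-1` [set x | x = 0])%classic by [].
apply: (@lipschitz_preimage_closed _ _ _ _ `|y|) => [x z|].
  by rewrite -linearBl mulrC hdot_normM.
apply/norm_closedP => x x0; apply: norm_lt_eq0 => e /x0[_ ->].
by rewrite subr0.
Qed.

Section Projection.
Variable M : closed_subspace H.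

Lemma csubZ a x : M x -> M (a *: x).
Proof. by move=> Mx; rewrite -[_ *: _]addr0; apply: csub_lin => //; exact: csub0. Qed.

Lemma csubD x y : M x -> M y -> M (x + y).
Proof. by move=> Mx My; rewrite -[x]scale1r; exact: csub_lin. Qed.

(** Midpoints of points of [M] lie in [M], so the parallelogram law makes almost minimal points
    accumulate. The infimum is taken over real parts because it must live in [R]. *)
Lemma csub_nearest x : exists2 m, M m & forall y, M y -> `|x - m| ^+ 2 <= `|x - y| ^+ 2.
Proof.
pose D := [set complex.Re (`|x - y| ^+ 2) | y in M]%classic.
have DE y : real_complex R (complex.Re (`|x - y| ^+ 2)) = `|x - y| ^+ 2.
  by rewrite -ge0C // exprn_ge0.
have infD : has_inf D.
  split; first by exists (complex.Re (`|x - 0| ^+ 2)), 0 => //; exact: csub0.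
  exists 0 => _ [y _ <-]; rewrite -lecR DE; exact: exprn_ge0.
pose d : C := real_complex R (inf D).
have d_le y : M y -> d <= `|x - y| ^+ 2.
  move=> My; rewrite -DE lecR; apply: ge_inf; first by case: infD.
  by exists y.
pose Q k y := M y /\ `|x - y| ^+ 2 < d + k.+1%:R^-1.
have [|k|e e0|m mQ] := @cauchy_approx_limit R H Q.
- move=> j k y jk [My xy]; split => //; apply: lt_le_trans xy _.
  by rewrite lerD2l lef_pV2 ?posrE ?ltr0Sn // ler_nat ltnS.
- have k0 : 0 < k.+1%:R^-1 :> R by rewrite invr_gt0.
  have [_ [y My <-]] := inf_adherent k0 infD.
  rewrite -ltcR DE rmorphD /= fmorphV rmorph_nat => xy; by exists y.
(* For [y], [z] in [Q k] the parallelogram law gives [|y - z|^2 < 4 (d + 1/(k+1)) - 4 d = 4/(k+1)],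
   whence the threshold [e^2 / 4]. *)
- have e4 : 0 < e ^+ 2 / 4 by rewrite divr_gt0 // exprn_gt0.
  have [k ke] := invSn_lt e4; exists k => y z [My xy] [Mz xz].
  rewrite -(@ltr_pXn2r _ 2) ?nnegrE ?(ltW e0) //.
  have mid : d <= `|x - 2^-1 *: (y + z)| ^+ 2.
    by apply: d_le; apply: csubZ; exact: csubD.
  have := hnorm_parallelogram (x - y) (x - z).
  have -> : x - y + (x - z) = 2 *: (x - 2^-1 *: (y + z)).
    by rewrite scalerBr scalerA divff ?pnatr_eq0 // scale1r scaler_nat mulr2n opprD addrACA.
  have -> : x - y - (x - z) = - (y - z).
    by rewrite !opprB addrC addrA subrK.
  rewrite normrN normrZ exprMn ger0_norm ?ler0n // => pE.
  have -> : `|y - z| ^+ 2 = 2 * `|x - y| ^+ 2 + 2 * `|x - z| ^+ 2 - 2 ^+ 2 * `|x - 2^-1 *: (y + z)| ^+ 2.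
    by apply/eqP; rewrite -pE eq_sym subr_eq addrC.
  apply: le_lt_trans (_ : _ <= 2 * `|x - y| ^+ 2 + 2 * `|x - z| ^+ 2 - 2 ^+ 2 * d) _.
    by rewrite lerB // ler_pM2l // exprn_gt0.
  rewrite ltrBlDr.
  apply: lt_le_trans (_ : 2 * (d + k.+1%:R^-1) + 2 * (d + k.+1%:R^-1) <= _).
    by rewrite ltrD // ltr_pM2l.
  have -> : 2 * (d + k.+1%:R^-1) + 2 * (d + k.+1%:R^-1) = 4 * k.+1%:R^-1 + 2 ^+ 2 * d by ring.
  by rewrite lerD2r mulrC -ler_pdivlMr // ltW.
have Mm : M m.
  have /norm_closedP := @csub_closed _ _ M; apply => e e0.
  by have [y [My _] my] := mQ e 0%N e0; exists y.
exists m => // y My; apply: le_trans (d_le y My).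
apply/ler_addgt0Pr => e /invSn_lt[k ke].
apply: le_trans (_ : d + k.+1%:R^-1 <= _); last by rewrite lerD2l ltW.
(* The point [y0] only serves to show [d + 1/(k+1)] nonnegative, so that its square root can be
   compared with [|x - m|]. *)
have [y0 [_ /ltW/(le_trans (exprn_ge0 2 (normr_ge0 _))) s0] _] := mQ 1 k ltr01.
rewrite -[leRHS]sqrtCK ler_pXn2r ?nnegrE ?sqrtC_ge0 //.
apply/ler_addgt0Pr => e' e'0; have [z [_ xz] mz] := mQ e' k e'0.
rewrite -(subrKA z); apply: le_trans (ler_normD _ _) _.
rewrite lerD //; last by rewrite distrC ltW.
by rewrite -(@ler_pXn2r _ 2) ?nnegrE ?sqrtC_ge0 // sqrtCK ltW.
Qed.

(** For the residual [z] at the nearest point, [c = <z, y>] and [t = c / <y, y>], one has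
    [|z - t y|^2 = |z|^2 - |c|^2 / <y, y>]; minimality forces [c = 0]. *)
Lemma csub_orthogonal_projection x :
  exists2 m, M m & forall y, M y -> hdot (x - m) y = 0.
Proof.
have [m Mm mmin] := csub_nearest x; exists m => // y My.
have [->|y0] := eqVneq y 0; first exact: linear0r.
have yy0 : 0 < hdot y y by rewrite dnorm_gt0.
have {mmin} : forall t, `|x - m| ^+ 2 <= `|x - m - t *: y| ^+ 2.
  by move=> t; rewrite -addrA -opprD; apply: mmin; apply: csubD => //; exact: csubZ.
move: (x - m) => z; set c := hdot z y; pose t := c / hdot y y.
move=> /(_ t); rewrite -scaleNr !hnormE dnormD /= dnormZ normrN linearZr_LR /= -/c.
rewrite rmorphN mulNr.
have yyR : (hdot y y)^* = hdot y y by rewrite -dot_conj.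
have -> : `|t| ^+ 2 * hdot y y = `|c| ^+ 2 / hdot y y.
  rewrite /t normrM normfV (ger0_norm (ltW yy0)) expr_div_n -mulrA.
  by congr (_ * _); rewrite expr2; field; rewrite gt_eqF.
have -> : t^* * c = `|c| ^+ 2 / hdot y y.
  by rewrite /t rmorphM fmorphV /= yyR normCK; ring.
rewrite rmorphN /= rmorphM fmorphV /= yyR conj_Creal ?rpredX ?normr_real //.
set a := _ / _; rewrite -[leLHS]addr0 -addrA lerD2l => a0.
have : a <= 0 by move: a0; rewrite addrA subrr add0r oppr_ge0.
rewrite pmulr_lle0 ?invr_gt0 // => c0.
have : `|c| ^+ 2 == 0 by rewrite eq_le c0 exprn_ge0.
by rewrite expf_eq0 normr_eq0 => /eqP.
Qed.

End Projection.
End HilbertGeometry.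

(** * Norm-preserving linear maps *)

Lemma linear_norm_hdot (R : realType) (H G : hilbertType R) (U : {linear H -> G}) :
  (forall x, `|U x| = `|x|) -> forall x y, hdot (U x) (U y) = hdot x y.
Proof.
move=> Unorm.
have key x y : hdot (U x) (U y) + (hdot (U x) (U y))^* = hdot x y + (hdot x y)^*.
  have := hnormE (U (x + y)); rewrite Unorm hnormE linearD !dnormD /=.
  by rewrite -!hnormE !Unorm => /addrI.
move=> x y; apply/eqP; rewrite -subr_eq0; set c := _ - _.
(* [key] compares twice the real parts. Scaling [x] by the conjugate of the discrepancy [c] turns
   that discrepancy into the real number [|c|^2], which must vanish. *)
have := key (c^* *: x) y.
rewrite linearZ !linearZl_LR /= => /eqP; rewrite -subr_eq0.
rewrite opprD addrACA -!rmorphB -mulrBr -/c -normCKC /=.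
rewrite conj_Creal ?rpredX ?normr_real // -mulr2n mulrn_eq0 /=.
by rewrite expf_eq0 normr_eq0.
Qed.

(** Preimages of points approaching [y] are as close to each other as their images, so they converge
    in the complete space [H]. *)
Lemma isometry_range_closed (R : realType) (H G : hilbertType R) (U : {linear H -> G}) :
  (forall x, `|U x| = `|x|) -> closed (range U).
Proof.
move=> Unorm; apply/norm_closedP => y yU.
pose Q k x := `|y - U x| < k.+1%:R^-1.
have [|k|e e0|x xQ] := @cauchy_approx_limit R H Q.
- move=> j k x jk /lt_le_trans; apply.
  by rewrite lef_pV2 ?posrE ?ltr0Sn // ler_nat ltnS.
- have [|_ [x _ <-] yx] := yU k.+1%:R^-1; first by rewrite invr_gt0.
  by exists x.
- have e2 : 0 < e / 2 by rewrite divr_gt0.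
  have [k ke] := invSn_lt e2.
  exists k => x x' yx yx'; rewrite -Unorm linearB /=.
  rewrite -(subrKA y); apply: le_lt_trans (ler_normD _ _) _.
  rewrite (splitr e) ltrD //; last exact: lt_trans ke.
  by rewrite distrC; exact: lt_trans ke.
exists x => //; apply/esym/eqP; rewrite -subr_eq0; apply/eqP.
apply: norm_lt_eq0 => e e0.
have e2 : 0 < e / 2 by rewrite divr_gt0.
have [k ke] := invSn_lt e2; have [x' yx' xx'] := xQ _ k e2.
rewrite -(subrKA (U x')); apply: le_lt_trans (ler_normD _ _) _.
rewrite (splitr e) ltrD //; first exact: lt_trans ke.
by rewrite -linearB Unorm distrC.
Qed.

(** * Separability of closed subspaces and of Fock spaces *)

Section Separability.
Variable R : realType.
Local Notation C := R[i].

(** Stated for an indexed family, so that countability is a property of the index type. *)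
Definition norm_dense (T : Type) (V : normedModType C) (g : T -> V) : Prop :=
  forall x (e : C), 0 < e -> exists t, `|x - g t| < e.

Lemma separable_norm_dense (V : normedModType C) :
  separable V -> exists g : nat -> V, norm_dense g.
Proof.
move=> [D [/countable_injP[f f_inj] Ddense]].
(* Indices not attained by [f] on [D] get the value 0; only the indices [f y] with [y] in [D] are
   used. *)
exists (fun k => xget 0 [set x | D x /\ f x = k]%classic) => x e e0.
have xe : nbhs x (ball x e) by exact: nbhsx_ballx.
have [|y [/interior_subset + Dy]] := Ddense _ _ (open_interior (ball x e)).
  by exists x.
rewrite -ball_normE /= => xy; exists (f y); case: xgetP => [z _ [Dz zy]|/(_ y)].
  by rewrite (f_inj z y) ?inE.
by case.
Qed.

Lemma norm_dense_separable (T : countType) (V : normedModType C) (g : T -> V) :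
  norm_dense g -> separable V.
Proof.
move=> gV; exists (range g); split.
  by apply: sub_countable (card_image_le _ _) _; exact: countableP.
move=> O [x Ox] Oopen.
have /nbhs_ballP[e e0 eO] : nbhs x O by exact: open_nbhs_nbhs.
have [t xt] := gV x e e0; exists (g t); split; last by exists t.
by apply: eO; rewrite -ball_normE.
Qed.

(** A dense sequence of [H] may miss [K]. For each pair [(k, j)] a point of [K] within [1/(j+1)] of
    [g k] is chosen, if there is one, and 0 otherwise. *)
Lemma separable_csub (H : hilbertType R) (K : closed_subspace H) :
  separable H -> separable (csub_type K).
Proof.
move=> /separable_norm_dense[g gH].
pose near (p : nat * nat) (y : csub_type K) := `|g p.1 - (y : H)| < p.2.+1%:R^-1.
have /choice[h hP] : forall p, exists y, (exists y', near p y') -> near p y.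
  move=> p; have [[y py]|no] := pselect (exists y, near p y); first by exists y.
  by exists 0 => /no.
suff hdense : norm_dense h by exact: norm_dense_separable hdense.
move=> x e e0; have e2 : 0 < e / 2 by rewrite divr_gt0.
have [j je] := invSn_lt e2.
have j0 : 0 < j.+1%:R^-1 :> C by rewrite invr_gt0.
have [k xk] := gH (x : H) _ j0.
have kx : near (k, j) x by rewrite /near distrC.
exists (k, j); rewrite [ltLHS](_ : _ = `|(x : H) - (h (k, j) : H)|) // -(subrKA (g k)).
apply: le_lt_trans (ler_normD _ _) _; rewrite (splitr e) ltrD //.
  by rewrite distrC; exact: lt_trans je.
by have /lt_trans := hP (k, j) (ex_intro (near (k, j)) x kx); apply.
Qed.

HB.instance Definition _ n (E : hilbertType R) (f : fock n C) :=
  GRing.isLinear.Build C E (fock n E) _ (tensor f) (tensor_linearr f).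

Lemma norm_ket_tensor n (E : hilbertType R) (w : seq 'I_n) (y : E) :
  `|ket R w ⊗ y| = `|y|.
Proof.
apply/eqP; rewrite -(@eqrXn2 _ 2) // (hnormE (_ ⊗ _)) hdot_tensor hdot_ket eqxx mul1r.
by rewrite hnormE.
Qed.

(** The countable dense family consists of finite sums of vectors [e_w ⊗ d k], indexed by lists.
    Approximable vectors are stable under addition, so they include all truncations. *)
Lemma separable_fock n (E : hilbertType R) : separable E -> separable (fock n E).
Proof.
move=> /separable_norm_dense[d dE].
pose g (l : seq (seq 'I_n * nat)) := \sum_(p <- l) ket R p.1 ⊗ d p.2.
pose approx x := forall e : C, 0 < e -> exists l, `|x - g l| < e.
suff gdense : norm_dense g by exact: norm_dense_separable gdense.
suff : forall x, approx x by [].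
have approx0 : approx 0.
  by move=> e e0; exists [::]; rewrite /g big_nil subrr normr0.
have approxD x y : approx x -> approx y -> approx (x + y).
  move=> xg yg e e0; have e2 : 0 < e / 2 by rewrite divr_gt0.
  have [[l xl] [l' yl]] := (xg _ e2, yg _ e2).
  exists (l ++ l'); rewrite /g big_cat /= opprD addrACA.
  by apply: le_lt_trans (ler_normD _ _) _; rewrite (splitr e) ltrD.
have approx_ket w y : approx (ket R w ⊗ y).
  move=> e /(dE y)[k yk]; exists [:: (w, k)]; rewrite /g big_seq1 /=.
  by rewrite -(linearB (tensor (ket R w))) norm_ket_tensor.
move=> x e e0; have e2 : 0 < e / 2 by rewrite divr_gt0.
have /cvgrPdist_lt/(_ _ e2)/filter_ex[N xN] := @truncation_cvg _ _ _ x.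
have /(_ _ e2)[l Nl] : approx (truncation x N).
  rewrite /truncation; elim/big_rec: _ => [|k y _ yg]; first exact: approx0.
  apply: (approxD) yg; rewrite /level_sum.
  elim/big_rec: _ => [|w z _ zg]; first exact: approx0.
  by apply: (approxD) zg; exact: approx_ket.
exists l; rewrite -(subrKA (truncation x N)).
by apply: le_lt_trans (ler_normD _ _) _; rewrite (splitr e) ltrD.
Qed.

End Separability.

(** [A y] is the preimage under [T] of the orthogonal projection of [y] onto the closed range of
    [T]. *)
Lemma isometry_adjoint (R : realType) (H G : hilbertType R) (T : {linear H -> G}) :
  (forall x, `|T x| = `|x|) ->
  exists A : {linear G -> H}, forall y x, hdot (A y) x = hdot y (T x).
Proof.
move=> Tnorm; have Tdot := linear_norm_hdot Tnorm.
have T0 : range T 0 by exists 0; rewrite ?linear0.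
have Tlin (a : R[i]) (y z : G) : range T y -> range T z -> range T (a *: y + z).
  by move=> [u _ <-] [v _ <-]; exists (a *: u + v); rewrite ?linearP.
pose M := ClosedSubspace T0 Tlin (isometry_range_closed Tnorm).
have /choice[A AE] : forall y, exists x, forall z, hdot x z = hdot y (T z).
  move=> y; have [_ [x _ <-] yx] := csub_orthogonal_projection M y.
  exists x => z; rewrite -Tdot; apply/esym/eqP; rewrite -subr_eq0.
  by have := yx (T z) (ex_intro2 _ _ z I erefl); rewrite linearBl => yxz; exact/eqP.
have Alin : linear A.
  by move=> a y z; apply: hdot_ext => x; rewrite AE !linearPl /= -!AE.
pose A' := HB.pack_for {linear G -> H} A (GRing.isLinear.Build _ _ _ _ A Alin).
by exists A'.
Qed.

(** * Wold decomposition of isometries with orthogonal ranges *)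

Section Wold.
Local Open Scope classical_set_scope.
Variables (R : realType) (n : nat) (H : hilbertType R).
Local Notation C := R[i].
Variable T : 'I_n -> {linear H -> H}.
Hypothesis T_hdot : forall i j x y, hdot (T i x) (T j y) = (i == j)%:R * hdot x y.
Variable A : 'I_n -> {linear H -> H}.
Hypothesis A_adjoint : forall i x y, hdot (A i x) y = hdot x (T i y).
Implicit Types (x y : H) (w : seq 'I_n).

Lemma adjoint_isometries i j x : A i (T j x) = if i == j then x else 0.
Proof.
apply: hdot_ext => z; rewrite A_adjoint T_hdot eq_sym.
by case: eqP => _; rewrite ?mul1r // mul0r linear0l.
Qed.

Lemma hdot_sumr x (I : Type) (r : seq I) (F : I -> H) :
  hdot x (\sum_(i <- r) F i) = \sum_(i <- r) hdot x (F i).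
Proof. exact: (big_morph (hdot x) (@linearDr _ _ _ _ _ _ hdot x) (linear0r hdot x)). Qed.

Lemma hdot_sum_isometries x (y : 'I_n -> H) :
  hdot x (\sum_i T i (y i)) = \sum_i hdot (A i x) (y i).
Proof. by rewrite hdot_sumr; apply: eq_bigr => i _; rewrite A_adjoint. Qed.

Lemma adjoint_sum j (y : 'I_n -> H) : A j (\sum_i T i (y i)) = y j.
Proof.
rewrite linear_sum (bigD1 j) //= adjoint_isometries eqxx big1 ?addr0 // => i ij.
by rewrite adjoint_isometries eq_sym (negPf ij).
Qed.

Lemma norm_sum_isometries (y : 'I_n -> H) :
  `|\sum_i T i (y i)| ^+ 2 = \sum_i `|y i| ^+ 2.
Proof.
rewrite hnormE hdot_sum_isometries; apply: eq_bigr => i _.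
by rewrite adjoint_sum hnormE.
Qed.

Definition defect x := x - \sum_i T i (A i x).

Lemma adjoint_defect i x : A i (defect x) = 0.
Proof. by rewrite linearB /= adjoint_sum subrr. Qed.

Lemma defect_linear : linear defect.
Proof.
move=> a x y; rewrite /defect scalerBr scaler_sumr addrACA -opprD -big_split.
by congr (_ - _); apply: eq_bigr => i _; rewrite !linearP.
Qed.

Definition wandering_set x := forall i, A i x = 0.

Lemma wandering0 : wandering_set 0.
Proof. by move=> i; rewrite linear0. Qed.

Lemma wandering_lin (a : C) x y :
  wandering_set x -> wandering_set y -> wandering_set (a *: x + y).
Proof. by move=> x0 y0 i; rewrite linearP x0 y0 scaler0 addr0. Qed.

(** By adjointness this is the intersection of the closed sets [<x, T i z> = 0] over all [i] and
    [z]. *)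
Lemma wandering_closed : closed wandering_set.
Proof.
apply/norm_closedP => x xA i; apply: hdot_ext => z; rewrite A_adjoint linear0l.
have /norm_closedP := @hdot_eq0_closed _ _ (T i z); apply => e /xA[y yA xy].
by exists y => //=; rewrite -A_adjoint yA linear0l.
Qed.

Definition wandering : closed_subspace H :=
  ClosedSubspace wandering0 wandering_lin wandering_closed.
Local Notation K := (csub_type wandering).

Definition wandering_part x : K :=
  @csub_of _ _ wandering (defect x) (fun i => adjoint_defect i x).

Lemma wandering_part_linear : linear wandering_part.
Proof. by move=> a x y; apply: val_inj; exact: defect_linear. Qed.

HB.instance Definition _ :=
  GRing.isLinear.Build C H K _ wandering_part wandering_part_linear.

Lemma wandering_part_id (p : K) : wandering_part p = p.
Proof.
apply: val_inj; rewrite /= /defect big1 ?subr0 // => i _.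
by rewrite (csub_inS p i) linear0.
Qed.

Lemma wandering_part_isometry i x : wandering_part (T i x) = 0.
Proof.
apply: val_inj; rewrite /= /defect (bigD1 i) //= adjoint_isometries eqxx big1 ?addr0 ?subrr //.
by move=> j /negPf ji; rewrite adjoint_isometries ji linear0.
Qed.

(** Pythagoras for [x = defect x + \sum_i T i (A i x)], the one-letter case of the energy
    identity. *)
Lemma norm_wandering_part x :
  `|x| ^+ 2 = `|wandering_part x| ^+ 2 + \sum_i `|A i x| ^+ 2.
Proof.
rewrite csub_normE /= -norm_sum_isometries -hnorm_pythagoras ?subrK //.
by rewrite hdot_sum_isometries big1 // => i _; rewrite adjoint_defect linear0l.
Qed.

(** The left fold applies the adjoint of the first letter first: this is the adjoint of
    [T_(w_1) ... T_(w_k)]. *)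
Definition adjoint_word w x := foldl (fun y i => A i y) x w.

Lemma adjoint_word_linear w : linear (adjoint_word w).
Proof.
elim: w => [|i w IH] a x y //=.
by rewrite /adjoint_word /= linearP; exact: IH.
Qed.

(* The sum of T_w A_w x over the words w of length N. *)
Fixpoint wold_remainder N x :=
  if N is N'.+1 then \sum_i T i (wold_remainder N' (A i x)) else x.

Lemma hdot_wold_remainder N x :
  hdot x (wold_remainder N x) = `|wold_remainder N x| ^+ 2.
Proof.
elim: N x => [|N IH] x /=; first by rewrite hnormE.
rewrite hdot_sum_isometries norm_sum_isometries.
by apply: eq_bigr => i _; rewrite IH.
Qed.

Definition wold_fun x w : K := wandering_part (adjoint_word w x).

(** Induction on [N]: [norm_wandering_part] splits off the empty word, and the nonempty words are
    grouped by first letter [i], where the induction hypothesis applies to [A i x]. *)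
Lemma wold_energy N x :
  series (level_sum (fun w => `|wold_fun x w| ^+ 2)) N + `|wold_remainder N x| ^+ 2
  = `|x| ^+ 2.
Proof.
elim: N x => [|N IH] x; first by rewrite /series /= big_geq // add0r.
rewrite /= norm_sum_isometries [RHS]norm_wandering_part.
rewrite /series /= big_nat_recl // -addrA; congr (_ + _).
  rewrite /level_sum (big_pred1 [tuple]) //= => w.
  by rewrite [w]tuple0; apply/esym/eqP.
under eq_bigr do rewrite level_sum_cons.
rewrite exchange_big /= -big_split /=; apply: eq_bigr => i _.
exact: IH.
Qed.

Lemma wold_square_summable x : `[< square_summable (wold_fun x) >].
Proof.
apply/asboolP/square_summableP; exists (`|x| ^+ 2) => N.
by rewrite -(wold_energy N) lerDl exprn_ge0.
Qed.

Definition wold_map x : fock n K := Fock (wold_square_summable x).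

Lemma wold_map_linear : linear wold_map.
Proof.
move=> a x y; apply: fock_ext => w; rewrite fockD fockZ /= /wold_fun.
by rewrite adjoint_word_linear linearP.
Qed.

HB.instance Definition _ :=
  GRing.isLinear.Build C H (fock n K) _ wold_map wold_map_linear.

Lemma adjoint_word0 w : adjoint_word w 0 = 0.
Proof. by elim: w => //= i w; rewrite /adjoint_word /= linear0. Qed.

(** At the empty word [T i x] has no wandering part; at [j :: w] the relation between [A j] and
    [T i] selects [j = i]. *)
Lemma wold_map_creation i x : wold_map (T i x) = creation i (wold_map x).
Proof.
apply: fock_ext => -[|j w]; rewrite creationE /= /wold_fun /=.
  exact: wandering_part_isometry.
by rewrite adjoint_isometries; case: eqP => // _; rewrite adjoint_word0 linear0.
Qed.

Lemma wold_map_wandering (p : K) : wold_map p = ket R [::] ⊗ p.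
Proof.
apply: fock_ext => -[|i w]; rewrite tensorE ketE /= /wold_fun /=.
  by rewrite wandering_part_id scale1r.
by rewrite (csub_inS p i) adjoint_word0 linear0 scale0r.
Qed.

(** Purity: the component of [x] in the ranges of long words dies out. [fock_subspace_pure] supplies
    it for subspaces of Fock space. *)
Hypothesis T_pure : forall x, (wold_remainder^~ x) @ \oo --> (0 : H).

Lemma norm_wold_map x : `|wold_map x| = `|x|.
Proof.
apply/eqP; rewrite -(@eqrXn2 _ 2) // fock_normsq fock_dotxx; apply/eqP.
apply: cvg_lim; first exact: norm_hausdorff.
rewrite (_ : series _ = fun N => `|x| ^+ 2 - `|wold_remainder N x| ^+ 2); last first.
  by apply/funext => N; rewrite -(wold_energy N) addrK.
rewrite -[X in _ --> X]subr0; apply: cvgB; first exact: cvg_cst.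
have rem0 : (fun N => `|wold_remainder N x|) @ \oo --> (0 : C).
  by rewrite -(normr0 H); exact: cvg_norm (T_pure x).
by rewrite -(mulr0 (0 : C)); exact: (cvgM rem0 rem0).
Qed.

(** The range is closed and contains every truncation of [f]. *)
Lemma wold_map_surjective (f : fock n K) : exists x, wold_map x = f.
Proof.
have range0 : range wold_map 0 by exists 0; rewrite ?linear0.
have rangeD g h : range wold_map g -> range wold_map h -> range wold_map (g + h).
  by move=> [x _ <-] [y _ <-]; exists (x + y); rewrite ?linearD.
have range_ket w p : range wold_map (ket R w ⊗ p).
  elim: w => [|i w [x _ xw]]; first by exists (p : H) => //; exact: wold_map_wandering.
  by exists (T i x); rewrite // wold_map_creation xw creation_tensor creation_ket.
suff [x _ xf] : range wold_map f by exists x.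
have /norm_closedP := isometry_range_closed norm_wold_map; apply => e e0.
have /cvgrPdist_lt/(_ _ e0)/filter_ex[N fN] := @truncation_cvg _ _ _ f.
exists (truncation f N) => //; rewrite /truncation.
elim/big_rec: _ => [|k y _ yr]; first exact: range0.
apply: (rangeD) yr; rewrite /level_sum.
elim/big_rec: _ => [|w z _ zr]; first exact: range0.
by apply: (rangeD) zr; exact: range_ket.
Qed.

Lemma wold_map_unitary : unitary wold_map.
Proof.
split; last exact: wold_map_surjective.
exact: linear_norm_hdot norm_wold_map.
Qed.

End Wold.

(** * Inverses of unitaries and linearity of restrictions *)

Lemma unitary_inverse (R : realType) (H G : hilbertType R) (U : {linear H -> G}) :
  unitary U -> exists V : {linear G -> H},
    [/\ cancel U V, cancel V U & forall y, `|V y| = `|y|].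
Proof.
move=> [Udot /choice[V UV]].
have Uinj : injective U.
  move=> x y Uxy; apply: hdot_ext => z.
  by rewrite -Udot Uxy Udot.
have Vlin : linear V.
  by move=> a x y; apply: Uinj; rewrite linearP !UV.
exists (HB.pack_for {linear G -> H} V (GRing.isLinear.Build _ _ _ _ V Vlin)).
split=> [x|//|y] /=; first by apply: Uinj; rewrite UV.
by apply/eqP; rewrite -(@eqrXn2 _ 2) // (hnormE (V y)) -Udot UV -hnormE.
Qed.

Section SubRestrict.
Variables (R : realType) (H : hilbertType R) (S : closed_subspace H).
Variables (T : {linear H -> H}) (TS : forall x, S x -> S (T x)).

Lemma sub_restrict_linear : linear (sub_restrict TS).
Proof. by move=> a x y; apply: val_inj; rewrite /= linearP. Qed.

HB.instance Definition _ :=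
  GRing.isLinear.Build R[i] (csub_type S) (csub_type S) _ (sub_restrict TS)
    sub_restrict_linear.
End SubRestrict.

(** * Creation operators and purity of their restrictions *)

Section FockSpace.
Variables (R : realType) (n : nat) (E : hilbertType R).
Local Notation C := R[i].
Local Open Scope classical_set_scope.
Implicit Types f g : fock n E.

Lemma fock_hdot_eq0 f g : (forall w, hdot (f w) (g w) = 0) -> hdot f g = 0.
Proof.
move=> fg0; apply: fock_dot_eq; rewrite (_ : series _ = fun=> 0); first exact: cvg_cst.
apply/funext => N; rewrite /series /= big1 // => k _.
by rewrite /level_sum big1.
Qed.

Lemma hdot_creation (i j : 'I_n) f g :
  hdot (creation i f) (creation j g) = (i == j)%:R * hdot f g.
Proof.
(* The shift drops the empty word, where created vectors vanish, and matches level [k+1] on the left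
   with level [k] on the right. *)
apply: fock_dot_eq; rewrite -cvg_shiftS.
rewrite (_ : (fun N => _) = fun N => (i == j)%:R *
    (series (level_sum (fun w => hdot (f w) (g w))) N : C)); last first.
  apply/funext => N; rewrite /series /= big_nat_recl //= mulr_sumr.
  rewrite [X in X + _]big1 ?add0r => [|w _]; last first.
    by rewrite tuple0 linear0l.
  apply: eq_bigr => k _; rewrite level_sum_cons.
  rewrite (bigD1 i) //= [X in _ + X]big1 ?addr0 => [|l /negPf li]; last first.
    by rewrite /level_sum big1 // => w _; rewrite li linear0l.
  rewrite eqxx; case: eqP => _; first by rewrite mul1r.
  by rewrite mul0r /level_sum big1 // => w _; rewrite linear0r.
by apply: cvgM; [exact: cvg_cst|exact: fock_dot_cvg].
Qed.

Lemma ket_nseq_tensor (l : 'I_n) j w (x : E) :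
  ket R (nseq j l ++ w) ⊗ x = iter j (creation l) (ket R w ⊗ x).
Proof. by elim: j => //= j <-; rewrite creation_tensor creation_ket. Qed.

Section Pure.
Variable S : closed_subspace (fock n E).
Hypothesis S_creation : forall i : 'I_n, invariant_subspace S (creation i).
Let T (i : 'I_n) : {linear csub_type S -> csub_type S} := sub_restrict (S_creation i).
Variable A : 'I_n -> {linear csub_type S -> csub_type S}.
Hypothesis A_adjoint : forall i x y, hdot (A i x) y = hdot x (T i y).

(** Each of the [N] outer creation operators prefixes one letter. *)
Lemma wold_remainder_fock0 N (x : csub_type S) w :
  (size w < N)%N -> csub_val (wold_remainder T A N x) w = 0.
Proof.
elim: N x w => //= N IH x w wN.
apply: (big_ind (fun y : csub_type S => csub_val y w = 0)) => //.
  by move=> y z yw zw; rewrite fockD yw zw addr0.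
move=> i _; rewrite creationE; case: w wN => // j v /= vN.
by case: eqP => // _; exact: IH.
Qed.

Lemma fock_subspace_pure (x : csub_type S) :
  (wold_remainder T A ^~ x) @ \oo --> (0 : csub_type S).
Proof.
have T_hdot i j y z : hdot (T i y) (T j z) = (i == j)%:R * hdot y z.
  exact: hdot_creation.
apply/cvgrPdist_lt => e e0.
have /cvgrPdist_lt/(_ _ e0) := @truncation_cvg _ _ _ (csub_val x).
apply: filterS => N; apply: le_lt_trans; rewrite sub0r normrN.
set r := wold_remainder T A N x.
have [->|r0] := eqVneq r 0; first by rewrite normr0.
have r_gt0 : 0 < `|r| by rewrite normr_gt0.
(* [r] vanishes on the words that support the truncation, so only the tail of [x] meets [r];
   Cauchy-Schwarz then allows division by [|r|]. *)
have xr : hdot (csub_val x - truncation (csub_val x) N) (csub_val r) = `|r| ^+ 2.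
  rewrite -(hdot_wold_remainder T_hdot A_adjoint) -/r.
  rewrite linearBl /= [X in _ - X]fock_hdot_eq0 ?subr0 // => w.
  rewrite truncationE; case: ltnP => wN; last exact: linear0l.
  by rewrite wold_remainder_fock0 // linear0r.
have := hdot_normM (csub_val x - truncation (csub_val x) N) (csub_val r).
by rewrite xr normrX normr_id expr2 ler_pM2r.
Qed.

End Pure.
End FockSpace.

(** * Recovering the odometer map from the odometer relations *)

Section FockRepresentation.
Variables (R : realType) (n : nat) (n_gt0 : (0 < n)%N) (E : hilbertType R).
Variable W : {linear fock n E -> fock n E}.
Hypothesis W_bounded : bounded_operator W.
Hypothesis W_rep : odometer_representation n_gt0 W (@creation R n E).

(** Moving [W] past powers of the last creation operator turns them into powers of the first; what
    remains is a value on a vacuum vector or one step from letter [i] to its successor. *)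
Lemma fock_representation_vacuum :
  fock_representation n_gt0 (W \o tensor (ket R [::])) W.
Proof.
have [Wnext Wlast] := W_rep; have [M WM] := W_bounded.
have W_iter j f : W (iter j (creation (last_letter n_gt0)) f)
    = iter j (creation (first_letter n_gt0)) (W f).
  by elim: j => //= j <-; rewrite Wlast.
split=> //; first by exists M => y /=; rewrite -(@norm_ket_tensor R n E [::] y); exact: WM.
split=> [//|m y _|j i i' w y ii'].
  by rewrite -[nseq m _]cats0 ket_nseq_tensor W_iter.
rewrite !ket_nseq_tensor W_iter; congr iter.
by rewrite -!creation_ket -!creation_tensor; exact: Wnext.
Qed.
End FockRepresentation.

(** * Transport of the subrepresentation to the Fock space over its wandering subspace *)

Theorem corollary1p11 (R : realType) (n : nat) (n_gt0 : (0 < n)%N)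
    (E : hilbertType R) (E_sep : separable E)
    (L : {linear E -> fock n E}) (W : {linear fock n E -> fock n E})
    (WL_fock : fock_representation n_gt0 L W)
    (S : closed_subspace (fock n E))
    (S_creation : forall i : 'I_n, invariant_subspace S (creation i))
    (S_W : invariant_subspace S W) :
  exists (E' : hilbertType R) (L' : {linear E' -> fock n E'})
      (W' : {linear fock n E' -> fock n E'}),
    [/\ separable E', fock_representation n_gt0 L' W'
      & unitarily_equivalent
          (op_tuple (sub_restrict S_W) (fun i => sub_restrict (S_creation i)))
          (op_tuple W' (@creation R n E'))].
Proof.
have [_ [M WM] _ [Wnext Wlast]] := WL_fock.
pose T (i : 'I_n) : {linear csub_type S -> csub_type S} := sub_restrict (S_creation i).
have T_hdot i j x y : hdot (T i x) (T j y) = (i == j)%:R * hdot x y.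
  exact: hdot_creation.
have T_norm i x : `|T i x| = `|x|.
  by apply/eqP; rewrite -(@eqrXn2 _ 2) // (hnormE (T i x)) T_hdot eqxx mul1r -hnormE.
have /choice[A A_adjoint] : forall i, exists A : {linear csub_type S -> csub_type S},
    forall x y, hdot (A x) y = hdot x (T i y).
  by move=> i; exact: isometry_adjoint (T_norm i).
have U_unitary := wold_map_unitary T_hdot A_adjoint (fock_subspace_pure A_adjoint).
have UT := wold_map_creation T_hdot A_adjoint.
pose E' : hilbertType R := csub_type (wandering A_adjoint).
pose U : {linear csub_type S -> fock n E'} := wold_map T_hdot A_adjoint.
have [V [UK VK Vnorm]] := unitary_inverse (U_unitary : unitary U).
pose WS : {linear csub_type S -> csub_type S} := sub_restrict S_W.
(* Conjugation by the isometric maps [U] and [V] preserves the bound [M]. *)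
pose W' : {linear fock n E' -> fock n E'} := U \o WS \o V.
have Unorm x : `|U x| = `|x| by rewrite -Vnorm UK.
have W'_bounded : bounded_operator W'.
  by exists M => f; rewrite /= Unorm -(Vnorm f); exact: WM.
have W'_rep : odometer_representation n_gt0 W' (@creation R n E').
  (* Writing [f = U (V f)] reduces both relations to those of [W] at the vector [V f] of [S]. *)
  split=> [i i' ii' f|f]; rewrite -(VK f) -UT /= !UK -UT; congr (U _); apply: val_inj.
    exact: Wnext.
  exact: Wlast.
exists E', (W' \o tensor (ket R [::])), W'; split.
(* Two layers: the wandering subspace lies in [S], and [S] in [fock n E]. *)
- exact/separable_csub/separable_csub/separable_fock.
- exact: fock_representation_vacuum.
- exists U; split=> // k x; rewrite /op_tuple; case: (unlift _ k) => [i|] /=.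
    exact: UT.
  by rewrite UK.
Qed.
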